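(* Let $A$ be a commutative $\mathbb{R}$-algebra with $1$ (not necessarily finitely generated) and let $M$ be a quadratic module of $A$ (not necessarily finitely generated). If every maximal semiordering of $A$ lying over $M$ is archimedean, then $\mathcal{K}_M$ is compact and $$(M^{\ddagger})^{\ddagger}=\overline{M}=\operatorname{Pos}(\mathcal{K}_M).$$ In particular, $(M^{\ddagger})^{\ddagger}$ is archimedean.
   Context: $\mathbb{R}^+$ denotes the set of nonnegative real numbers. A quadratic module of $A$ is a subset $Q\subseteq A$ with $Q+Q\subseteq Q$, $f^2Q\subseteq Q$ for all $f\in A$, and $1\in Q$. A semiordering of $A$ is a quadratic module $Q$ of $A$ such that $Q\cup -Q=A$ and $Q\cap -Q$ is a prime ideal of $A$. A maximal semiordering is one that is maximal with respect to inclusion (maximal semiorderings are the same as maximal proper quadratic modules); it lies over $M$ if it contains $M$. A quadratic module $Q$ is archimedean if for every $f\in A$ there is an integer $k\ge 0$ with $k+f\in Q$. $\mathcal{K}_M$ is the set of subsets of $A$ of the form $\alpha^{-1}(\mathbb{R}^+)$ for some ring homomorphism $\alpha:A\to\mathbb{R}$ with $M\subseteq\alpha^{-1}(\mathbb{R}^+)$; it is identified with the set of such $\alpha$ and carries the topology induced from the product topology on $\mathbb{R}^A$ via $\alpha\mapsto(\alpha(f))_{f\in A}$. $\operatorname{Pos}(\mathcal{K}_M):=\bigcap_{Q\in\mathcal{K}_M}Q$ (equal to $A$ if $\mathcal{K}_M=\emptyset$), i.e. the set of $f\in A$ with $\alpha(f)\ge 0$ for all such $\alpha$. $A$ is endowed,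 as a real vector space, with the finest locally convex topology (the vector space topology for which all convex, absorbent, symmetric subsets form a zero neighborhood base; $U$ is absorbent if for each $x$ there is $\lambda>0$ with $x\in\lambda U$, and symmetric if $\lambda U\subseteq U$ for all $|\lambda|\le 1$). For $C\subseteq A$, $\overline{C}$ is the closure of $C$ in this topology, and $C^{\ddagger}$ (the sequential closure) is the set of all elements of $A$ that are limits of sequences of elements of $C$. *)

(* Defs.v *)
From HB Require Import structures.
From mathcomp Require Import all_boot all_order all_algebra.
From mathcomp Require Import all_classical all_reals all_analysis.

Set Implicit Arguments.
Unset Strict Implicit.
Unset Printing Implicit Defensive.

Import Order.TTheory GRing.Theory Num.Theory.
Import numFieldNormedType.Exports.

Local Open Scope classical_set_scope.
Local Open Scope ring_scope.

Section QuadraticModules.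
Context {A : comPzRingType}.
Implicit Types (Q I : set A).

Definition quadratic_module Q : Prop :=
  [/\ forall f g, Q f -> Q g -> Q (f + g),
      forall f g, Q g -> Q (f ^+ 2 * g)
    & Q 1].

(* ring_quotient.prime_idealr_closed is only available over nonzero rings. *)
Definition is_prime_ideal I : Prop :=
  [/\ I 0,
      forall f g, I f -> I g -> I (f + g),
      forall f g, I g -> I (f * g),
      ~ I 1
    & forall f g, I (f * g) -> I f \/ I g].

Definition semiordering Q : Prop :=
  [/\ quadratic_module Q,
      Q `|` [set - f | f in Q] = setT
    & is_prime_ideal (Q `&` [set - f | f in Q])].

Definition maximal_semiordering Q : Prop :=
  semiordering Q /\ forall P, semiordering P -> Q `<=` P -> P = Q.

Definition archimedean Q : Prop :=
  quadratic_module Q /\ forall f, exists k : nat, Q (k%:R + f).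

End QuadraticModules.

Section RealPoints.
Variables (R : realType) (A : comPzRingType).
Implicit Types (M : set A) (alpha beta : {rmorphism A -> R}).

Definition nonneg_part (alpha : A -> R) : set A :=
  alpha @^-1` [set r | 0 <= r].

Definition K_ M : set (set A) :=
  [set Q | exists2 alpha : {rmorphism A -> R},
             M `<=` nonneg_part alpha & Q = nonneg_part alpha].

(* The homomorphisms with which the elements of [K_ M] are identified (see
   [nonneg_part_inj]), inside R^A with its product topology. *)
Definition Khom M : set {ptws A -> R} :=
  [set a : {ptws A -> R} | exists2 alpha : {rmorphism A -> R},
             M `<=` nonneg_part alpha & a = (alpha : A -> R)].

Definition Pos (K : set (set A)) : set A := \bigcap_(Q in K) Q.

Lemma nonneg_part_inj alpha beta :
  nonneg_part alpha = nonneg_part beta -> alpha =1 beta.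
Proof.
have lt_neq (a b : {rmorphism A -> R}) f :
    a f < b f -> nonneg_part a <> nonneg_part b.
  move=> /rat_in_itvoo[q]; rewrite in_itv/= => /andP[aq qb] eqab.
  pose d : int := denq q; pose n : int := numq q.
  have d0 : (0 : R) < d%:~R by rewrite ltr0z denq_gt0.
  have qE : ratr q = n%:~R / d%:~R :> R.
    by rewrite -[in LHS](divq_num_den q) fmorph_div/= !ratr_int.
  have vE (c : {rmorphism A -> R}) :
      c (f *~ d - n%:~R) = (c f - ratr q) * d%:~R.
    by rewrite rmorphB/= rmorphMz rmorph_int mulrBl qE divfK ?gt_eqF// mulrzr.
  have : nonneg_part b (f *~ d - n%:~R).
    by rewrite /nonneg_part/= vE mulr_ge0 ?ltW// subr_gt0.
  by rewrite -eqab /nonneg_part/= vE pmulr_lge0// subr_ge0 leNgt aq.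
move=> eqab f; apply/eqP; rewrite eq_le !leNgt.
by apply/andP; split; apply/negP => ltab; case: (lt_neq _ _ _ ltab).
Qed.

End RealPoints.

Arguments K_ R {A} M.
Arguments Khom R {A} M.

(* [A] as a real vector space, for a commutative R-algebra [A] given by its
   structure morphism; [comAlgType R] would exclude the zero algebra. *)
Definition alg_space (R : realType) (A : comPzRingType)
  (iota : {rmorphism R -> A}) : Type := A.

Section AlgSpace.
Variables (R : realType) (A : comPzRingType) (iota : {rmorphism R -> A}).

HB.instance Definition _ := GRing.Zmodule.copy (alg_space iota) A.

Let scale (r : R) (f : alg_space iota) : alg_space iota := iota r * (f : A).

Let scaleA r s f : scale r (scale s f) = scale (r * s) f.
Proof. by rewrite /scale rmorphM mulrA. Qed.

Let scale1 : left_id 1 scale.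
Proof. by move=> f; rewrite /scale rmorph1 mul1r. Qed.

Let scaleDr : right_distributive scale +%R.
Proof. by move=> r f g; rewrite /scale mulrDr. Qed.

Let scaleDl f : {morph scale^~ f : r s / r + s}.
Proof. by move=> r s; rewrite /scale rmorphD mulrDl. Qed.

HB.instance Definition _ := GRing.Zmodule_isLmodule.Build R (alg_space iota)
  scaleA scale1 scaleDr scaleDl.

End AlgSpace.

Section AbsorbentSymmetric.
Context {R : realType} {V : lmodType R}.
Implicit Types U : set V.

Definition absorbent U : Prop :=
  forall x, exists2 l : R, 0 < l & [set l *: u | u in U] x.

Definition symmetric_set U : Prop :=
  forall l : R, `|l| <= 1 -> [set l *: u | u in U] `<=` U.

Definition lc_base U : Prop :=
  [/\ convex_set U, absorbent U & symmetric_set U].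

End AbsorbentSymmetric.

(* A real vector space with its finest locally convex topology. *)
Definition finest_lc (R : realType) (V : lmodType R) : Type := V.

Section FinestLC.
Variables (R : realType) (V : lmodType R).
Local Notation T := (finest_lc V).

HB.instance Definition _ := GRing.Lmodule.copy T V.

Definition finest_nbhs (x : T) : set_system T :=
  [set U | exists2 W : set V, lc_base W & [set (x : V) + w | w in W] `<=` U].

Lemma lc_base_conv (W : set V) (t : R) u v : lc_base W ->
  0 <= t <= 1 -> W u -> W v -> W (t *: u + (1 - t) *: v).
Proof.
move=> [cW _ _] /andP[t0 t1] Wu Wv.
exact/set_mem/(cW u v (Itv01 t0 t1) (mem_set Wu) (mem_set Wv)).
Qed.

Lemma lc_baseZ (W : set V) (l : R) u : lc_base W ->
  `|l| <= 1 -> W u -> W (l *: u).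
Proof. by move=> [_ _ sW] l1 Wu; apply: (sW _ l1); exists u. Qed.

Lemma lc_base0 (W : set V) : lc_base W -> W 0.
Proof.
move=> bW; have [_ aW _] := bW; have [l _ [u Wu _]] := aW 0.
by rewrite -(scale0r u); apply: lc_baseZ; rewrite ?normr0.
Qed.

Lemma lc_base_scale (W : set V) (c : R) : lc_base W -> 0 < c ->
  lc_base [set w | W (c *: w)].
Proof.
move=> bW c0; have [_ aW _] := bW; split.
- move=> u v t; rewrite !inE/= => Wu Wv.
  rewrite [X in c *: X](_ : _ = t%:num *: u + (1 - t%:num) *: v)// scalerDr.
  rewrite !scalerA ![c * _]mulrC -!scalerA.
  by apply: lc_base_conv => //; rewrite ge0 le1.
- move=> x; have [l l0 [u Wu <-]] := aW x.
  exists (l * c); first exact: mulr_gt0.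
  exists (c^-1 *: u); first by rewrite /= scalerA divff ?gt_eqF// scale1r.
  by rewrite scalerA mulfK ?gt_eqF.
- move=> l l1 _ [u /= Wu <-].
  by rewrite scalerA mulrC -scalerA; exact: lc_baseZ.
Qed.

Lemma lc_baseT : lc_base [set: V].
Proof.
split=> [u v t|x|//]; first by rewrite !inE.
by exists 1 => //; exists x; rewrite ?scale1r.
Qed.

Lemma lc_base_absorb (W : set V) x : lc_base W ->
  exists2 l : R, 0 < l & forall m, `|m| <= l -> W (m *: x).
Proof.
move=> bW; have [_ aW _] := bW; have [l l0 [u Wu <-]] := aW x.
exists l^-1; first by rewrite invr_gt0.
move=> m ml; rewrite scalerA; apply: lc_baseZ => //.
by rewrite normrM (gtr0_norm l0) -ler_pdivlMr// mul1r.
Qed.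

Lemma lc_baseI (W1 W2 : set V) :
  lc_base W1 -> lc_base W2 -> lc_base (W1 `&` W2).
Proof.
move=> b1 b2; split.
- move=> u v t; rewrite !inE => -[u1 u2] [v1 v2].
  by split; [have [c _ _] := b1|have [c _ _] := b2];
    apply/set_mem/c; exact/mem_set.
- move=> x; have [l1 l10 h1] := lc_base_absorb x b1.
  have [l2 l20 h2] := lc_base_absorb x b2.
  pose l := Num.min l1 l2; have l0 : 0 < l by rewrite lt_min l10.
  exists l^-1; first by rewrite invr_gt0.
  exists (l *: x); last by rewrite scalerA mulVf ?gt_eqF// scale1r.
  by split; [apply: h1|apply: h2]; rewrite gtr0_norm// ge_min lexx ?orbT.
- by move=> l l1 _ [u [u1 u2] <-]; split; exact: lc_baseZ.
Qed.

Lemma lc_base_half (W : set V) u v : lc_base W ->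
  W (2 *: u) -> W (2 *: v) -> W (u + v).
Proof.
move=> bW Wu Wv.
have -> : u + v = 2^-1 *: (2 *: u) + (1 - 2^-1) *: (2 *: v) :> V.
  have -> : 1 - 2^-1 = 2^-1 :> R by rewrite [X in X - _](splitr 1) mul1r addrK.
  by rewrite !scalerA mulVf ?pnatr_eq0// !scale1r.
apply: lc_base_conv => //; rewrite invr_ge0 ler0n/=.
by rewrite invf_le1 ?ler1n.
Qed.

Let finest_nbhs_filter (x : T) : ProperFilter (finest_nbhs x).
Proof.
split.
  by move=> [W bW]; apply; exists 0; [exact: lc_base0|reflexivity].
split.
- by exists setT => //; exact: lc_baseT.
- move=> U1 U2 [W1 b1 s1] [W2 b2 s2]; exists (W1 `&` W2); first exact: lc_baseI.
  by move=> _ [w [w1 w2] <-]; split; [apply: s1|apply: s2]; exists w.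
- by move=> U1 U2 s [W bW sW]; exists W => //; exact: subset_trans s.
Qed.

Let finest_nbhs_singleton (x : T) (U : set T) : finest_nbhs x U -> U x.
Proof.
move=> [W bW sW]; apply: sW; exists 0; first exact: lc_base0.
exact: addr0.
Qed.

Let finest_nbhs_nbhs (x : T) (U : set T) :
  finest_nbhs x U -> finest_nbhs x (finest_nbhs^~ U).
Proof.
move=> [W bW sW]; exists [set w | W (2 *: w)].
  exact: lc_base_scale.
move=> _ [u /= Wu <-]; exists [set w | W (2 *: w)].
  exact: lc_base_scale.
move=> _ [v /= Wv <-]; apply: sW; exists (u + v); first exact: lc_base_half.
by rewrite addrA.
Qed.

HB.instance Definition _ := hasNbhs.Build T finest_nbhs.

HB.instance Definition _ := Nbhs_isNbhsTopological.Build T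
  finest_nbhs_filter finest_nbhs_singleton finest_nbhs_nbhs.

Let add_continuous : continuous (fun x : T * T => x.1 + x.2).
Proof.
move=> [x y] U [W bW sW] /=.
pose H : set V := [set w | W (2 *: w)].
have bH : lc_base H by exact: lc_base_scale.
exists ([set x + w | w in H], [set y + w | w in H]).
  by split; exists H.
move=> _ /= [[u Hu <-] [v Hv <-]]; apply: sW.
by exists (u + v); [exact: lc_base_half|rewrite addrACA].
Qed.

Let scale_continuous : continuous (fun z : R^o * T => z.1 *: z.2).
Proof.
move=> [r x] U [W bW sW] /=.
pose H : set V := [set w | W (2 *: w)].
have bH : lc_base H by exact: lc_base_scale.
have [l l0 hl] := lc_base_absorb (x : V) bH.
have c0 : 0 < `|r| + 1 :> R by rewrite ltr_wpDl.
exists ([set s : R^o | `|r - s| < Num.min l 1],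
        [set (x : V) + w | w in [set w | H ((`|r| + 1) *: w)]]).
  split=> /=.
    exists (Num.min l 1) => /=; first by rewrite lt_min l0 ltr01.
    by move=> s.
  by exists [set w | H ((`|r| + 1) *: w)] => //; exact: lc_base_scale.
move=> [s _] /= [rs [w Hw <-]]; apply: sW.
exists ((s - r) *: (x : V) + s *: w); last first.
  by rewrite scalerDr scalerBl addrA addrCA subrr addr0.
apply: lc_base_half => //.
  by apply: hl; rewrite distrC; apply/ltW/(lt_le_trans rs); rewrite ge_min lexx.
rewrite -/(H _).
have -> : s *: w = (s / (`|r| + 1)) *: ((`|r| + 1) *: w).
  by rewrite scalerA divfK ?gt_eqF.
apply: (lc_baseZ bH _ Hw); rewrite normrM normfV (gtr0_norm c0).
rewrite ler_pdivrMr// mul1r -(subrK r s) addrC (le_trans (ler_normD _ _))//.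
rewrite lerD2l distrC; apply/ltW/(lt_le_trans rs).
by rewrite ge_min lexx orbT.
Qed.

Let locally_convex : exists2 B : set_system T,
  (forall b, b \in B -> convex_set b) & basis B.
Proof.
exists [set U : set T | open U /\ convex_set U].
  by move=> b; rewrite inE => -[].
split; first by move=> U [].
move=> x U [W bW sW].
exists [set y : T | nbhs y [set x + w | w in W]]; last first.
  by move=> y /nbhs_singleton; exact: sW.
split; last by exists W.
split.
  by rewrite openE => y /= /nbhs_interior.
move=> y z t; rewrite !inE/= => -[W1 b1 s1] [W2 b2 s2].
exists (W1 `&` W2); first exact: lc_baseI.
move=> _ [w [w1 w2] <-].
have [u Wu xu] : [set x + w | w in W] (y + w) by apply: s1; exists w.
have [v Wv xv] : [set x + w | w in W] (z + w) by apply: s2; exists w.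
exists (t%:num *: u + (1 - t%:num) *: v).
  by apply: lc_base_conv => //; rewrite ge0 le1.
have -> : u = y + w - x :> V by rewrite -xu addrAC subrr add0r.
have -> : v = z + w - x :> V by rewrite -xv addrAC subrr add0r.
rewrite [X in _ = X + _](_ : _ = t%:num *: y + (1 - t%:num) *: z)//.
have -> : t%:num *: (y + w - x) + (1 - t%:num) *: (z + w - x) =
    t%:num *: y + (1 - t%:num) *: z + (w - x) :> V.
  rewrite -(addrA y) -(addrA z) !(scalerDr _ _ (w - x)) addrACA.
  by rewrite -[in X in _ + X]scalerDl addrCA subrr addr0 scale1r.
by rewrite addrC -addrA subrK.
Qed.

HB.instance Definition _ := PreTopologicalLmod_isTvs.Build R T
  add_continuous scale_continuous locally_convex.

End FinestLC.

Section Closures.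
Variables (R : realType) (A : comPzRingType) (iota : {rmorphism R -> A}).
Local Notation T := (finest_lc (alg_space iota)).

Definition lc_closure (C : set A) : set A := closure (C : set T).

Definition seq_closure (C : set A) : set A :=
  [set f | exists2 u : nat -> T, (forall n, C (u n)) & u n @[n --> \oo] --> (f : T)].

End Closures.

(* Main.v *)
From HB Require Import structures.
Require Import Defs.
From mathcomp Require Import all_boot all_order all_algebra.
From mathcomp Require Import all_classical all_reals all_analysis.
From mathcomp Require Import zify ring lra.

Set Implicit Arguments.
Unset Strict Implicit.
Unset Printing Implicit Defensive.

Import Order.TTheory GRing.Theory Num.Theory.
Import numFieldNormedType.Exports.

Local Open Scope classical_set_scope.
Local Open Scope ring_scope.

(** Two facts make the theorem true.

    First, a positivity certificate holds without any archimedean assumption on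
    the module M itself. If f is positive at every real point of M, then -1
    lies in the quadratic module generated by M and -f, so that s f - 1 lies
    in M for some sum of squares s ([positivstellensatz]). Otherwise Zorn's
    lemma extends this module to a maximal semiordering
    ([proper_sub_maximal_semiordering]). That semiordering is archimedean by
    hypothesis, hence contained in the nonnegativity set of a homomorphism
    alpha ([archimedean_total_sub_nonneg_part]), which would satisfy
    alpha(f) <= 0. The same dichotomy shows that each element of A is bounded
    on the real points ([bounded_on_points]). Hence the set of real points is a
    closed subset of a product of segments, and so it is compact.

    Secondly, one approximation step makes M archimedean. Let M' be the set of
    those f for which some g satisfies f + e g \in M for all e > 0. It lies in
    the sequential closure of M. Given a in A, scale a to x with |x| < 1 on all
    real points; the certificate gives p with p (1 - x^2) - 1 in M, and a
    geometric summation gives p - x^(2n) in M for every n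
    ([even_power_le]). On the other hand
      1 - x^2 + 2^-m (x^(2^(m+1)) - 1)
    is a sum of squares ([one_sub_sqr_approx]), so that 1 - x^2 + 2^-m p is in
    M for all m. Thus 1 - x^2 is in M', with g := p, and M' is archimedean
    ([eps_closure_archimedean]).

    For the archimedean module M' the certificate s f - 1 \in M' improves to
    f \in M' ([archimedean_positivstellensatz], Jacobi's theorem). Applied to
    f + e for all e > 0, this puts every f that is nonnegative on the real
    points into M'', hence into the second sequential closure. The remaining
    inclusions are soft: iterated sequential closures lie in the closure, and
    the closure lies in Pos(K_M) because every homomorphism A -> R is
    continuous for the finest locally convex topology. *)

(** * Quadratic modules of a commutative ring *)

Section Generalities.
Context {A : comPzRingType}.
Implicit Types (M Q : set A) (f g s : A).

Lemma qmD M f g : quadratic_module M -> M f -> M g -> M (f + g).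
Proof. by case=> MD _ _; exact: MD. Qed.

Lemma qm_sqrM M f g : quadratic_module M -> M g -> M (f ^+ 2 * g).
Proof. by case=> _ MM _; exact: MM. Qed.

Lemma qm1 M : quadratic_module M -> M 1.
Proof. by case. Qed.

Lemma qm_sqr M f : quadratic_module M -> M (f ^+ 2).
Proof. by move=> qM; rewrite -[_ ^+ 2]mulr1; apply: qm_sqrM => //; exact: qm1. Qed.

Lemma qm0 M : quadratic_module M -> M 0.
Proof. by move=> /(@qm_sqr _ 0); rewrite expr0n. Qed.

Lemma qm_nat M n : quadratic_module M -> M n%:R.
Proof.
move=> qM; elim: n => [|n IHn]; first exact: qm0.
by rewrite -natr1; apply: qmD => //; exact: qm1.
Qed.

Lemma suppE Q f : (Q `&` [set - g | g in Q]) f <-> Q f /\ Q (- f).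
Proof.
split=> -[Qf].
  by move=> [g Qg gf]; split=> //; rewrite -gf opprK.
by move=> QNf; split=> //; exists (- f); rewrite ?opprK.
Qed.

Definition sos : set A := [set s | exists l : seq A, s = \sum_(x <- l) x ^+ 2].

Lemma sos_sqr f : sos (f ^+ 2).
Proof. by exists [:: f]; rewrite big_seq1. Qed.

Lemma sosD s t : sos s -> sos t -> sos (s + t).
Proof. by move=> [l1 ->] [l2 ->]; exists (l1 ++ l2); rewrite big_cat. Qed.

Lemma sos_sqrM f s : sos s -> sos (f ^+ 2 * s).
Proof.
move=> [l ->]; exists [seq f * x | x <- l]; rewrite big_map big_distrr.
by apply: eq_bigr => x _; rewrite exprMn.
Qed.

Lemma qm_sosM M s g : quadratic_module M -> sos s -> M g -> M (s * g).
Proof.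
move=> qM [l ->] Mg; rewrite big_distrl/=; elim/big_ind: _ => //.
- exact: qm0.
- by move=> ? ?; exact: qmD.
- by move=> x _; exact: qm_sqrM.
Qed.

Lemma qm_sos M s : quadratic_module M -> sos s -> M s.
Proof. by move=> qM ss; rewrite -[s]mulr1; apply: qm_sosM => //; exact: qm1. Qed.

Definition qm_adjoin M f : set A :=
  [set g | exists m s, [/\ M m, sos s & g = m + s * f]].

Lemma qm_adjoin_sub M f : M `<=` qm_adjoin M f.
Proof.
move=> m Mm; exists m, 0; split=> //; first by exists [::]; rewrite big_nil.
by rewrite mul0r addr0.
Qed.

Lemma qm_adjoin_mem M f : quadratic_module M -> qm_adjoin M f f.
Proof.
move=> qM; exists 0, 1; split; first exact: qm0.
  by rewrite -(expr1n _ 2); exact: sos_sqr.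
by rewrite mul1r add0r.
Qed.

Lemma qm_adjoin_qm M f : quadratic_module M -> quadratic_module (qm_adjoin M f).
Proof.
move=> qM; split.
- move=> _ _ [m [s [Mm ss ->]]] [m' [s' [Mm' ss' ->]]].
  exists (m + m'), (s + s'); split; [exact: qmD|exact: sosD|].
  by rewrite mulrDl addrACA.
- move=> h _ [m [s [Mm ss ->]]].
  exists (h ^+ 2 * m), (h ^+ 2 * s); split; [exact: qm_sqrM|exact: sos_sqrM|].
  by rewrite mulrDr mulrA.
- by apply: qm_adjoin_sub; exact: qm1.
Qed.

(** The empty set is added to the family because Zorn's lemma also takes the
    union of the empty chain; it is not maximal, since M lies above it. *)
Lemma exists_maximal_proper_qm M : quadratic_module M -> ~ M (- 1) ->
  exists Q, [/\ quadratic_module Q, ~ Q (- 1), M `<=` Q &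
    forall P, quadratic_module P -> ~ P (- 1) -> Q `<=` P -> P = Q].
Proof.
move=> qM M1.
pose P X := X = set0 \/ [/\ quadratic_module X, ~ X (- 1) & M `<=` X].
have [F FP totF|Q [[Q0|[qQ Q1 MQ]] maxQ]] := @Zorn_bigcup A P.
- have [[X0 FX0 [f0 X0f0]]|F0] :=
      pselect (exists2 X, F X & exists f, X f); last first.
    left; rewrite -subset0 => f [X FX Xf]; apply: F0.
    by exists X => //; exists f.
  have nP X f : F X -> X f -> [/\ quadratic_module X, ~ X (- 1) & M `<=` X].
    by move=> FX Xf; have [X00|//] := FP _ FX; rewrite X00 in Xf.
  have [qX0 _ MX0] := nP _ _ FX0 X0f0.
  right; split; last by move=> f /MX0 ?; exists X0.
    split.
    + move=> f g [X FX Xf] [Y FY Yg].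
      have [qX _ _] := nP _ _ FX Xf; have [qY _ _] := nP _ _ FY Yg.
      have [XY|YX] := totF _ _ FX FY.
        by exists Y => //; apply: qmD => //; exact: XY.
      by exists X => //; apply: qmD => //; exact: YX.
    + move=> f g [X FX Xg]; have [qX _ _] := nP _ _ FX Xg.
      by exists X => //; exact: qm_sqrM.
    + by exists X0 => //; exact: qm1.
  by move=> [X FX X1]; have [] := nP _ _ FX X1.
- exfalso; apply: (maxQ M); last by right; split.
  by rewrite Q0; split=> [f []|/(_ 1 (qm1 qM))].
- exists Q; split=> // P' qP' P'1 QP'.
  apply/seteqP; split=> //; apply: contrapT => nP'Q.
  apply: (maxQ P'); first by split.
  by right; split=> //; exact: subset_trans QP'.
Qed.

(** Maximality in the form of an equation: adjoining g produces -1. *)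
Lemma maximal_qm_adjoin Q g : quadratic_module Q ->
  (forall P, quadratic_module P -> ~ P (- 1) -> Q `<=` P -> P = Q) ->
  ~ Q g -> exists q s, [/\ Q q, sos s & q = - 1 - s * g].
Proof.
move=> qQ maxQ nQg; have [q [s [Qq ss qE]]] : qm_adjoin Q g (- 1).
  apply: contrapT => n1; apply: nQg.
  rewrite -(maxQ _ (qm_adjoin_qm g qQ) n1 (@qm_adjoin_sub _ _)).
  exact: qm_adjoin_mem.
by exists q, s; split=> //; rewrite qE addrK.
Qed.

End Generalities.

(** * Maximal proper quadratic modules are semiorderings *)

Section RealAlgebras.
Context {R : realType} {A : comPzRingType}.
Variable iota : {rmorphism R -> A}.
Implicit Types (M Q : set A) (f g s : A).

Lemma exists_half : exists h : A, 2 * h = 1.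
Proof.
exists (iota 2^-1).
by rewrite -(rmorph_nat iota) -rmorphM divff ?pnatr_eq0// rmorph1.
Qed.

Lemma qm_scale M (r : R) f : quadratic_module M -> 0 <= r -> M f -> M (iota r * f).
Proof.
by move=> qM r0 Mf; rewrite -(sqr_sqrtr r0) rmorphXn; exact: qm_sqrM.
Qed.

Lemma qm_iota M (r : R) : quadratic_module M -> 0 <= r -> M (iota r).
Proof. by move=> qM r0; rewrite -[iota r]mulr1; apply: qm_scale => //; exact: qm1. Qed.

(** Every g is a difference of two squares, 4 g = (g + 1)^2 - (g - 1)^2; hence
    the support of a quadratic module is an ideal. *)
Lemma qm_supp_mul M f g : quadratic_module M -> M f -> M (- f) -> M (g * f).
Proof.
move=> qM Mf MNf; have [h half] := exists_half.
have -> : g * f = (h * (g + 1)) ^+ 2 * f + (h * (g - 1)) ^+ 2 * - f.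
  by transitivity ((2 * h) ^+ 2 * (g * f)); [rewrite half; ring|ring].
by apply: qmD => //; exact: qm_sqrM.
Qed.

(** With neither f nor -f in Q one has -1 = q + s f = r - t f for sums of squares
    s and t. Eliminating f gives s + t + t q + s r = 0, which puts s in the
    support of Q, and then s f, and then -1 in Q. *)
Lemma maximal_qm_total Q : quadratic_module Q -> ~ Q (- 1) ->
  (forall P, quadratic_module P -> ~ P (- 1) -> Q `<=` P -> P = Q) ->
  forall f, Q f \/ Q (- f).
Proof.
move=> qQ Q1 maxQ f; apply: contrapT => /not_orP[nQf nQNf].
have [q [s [Qq ss qE]]] := maximal_qm_adjoin qQ maxQ nQf.
have [r [t [Qr st rE]]] := maximal_qm_adjoin qQ maxQ nQNf.
have QNs : Q (- s).
  have -> : - s = t + (t * q + s * r) by rewrite qE rE; ring.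
  by apply: qmD => //; [exact: qm_sos|apply: qmD => //; exact: qm_sosM].
apply: Q1; have -> : - 1 = q + f * s by rewrite qE; ring.
apply: qmD => //.
by apply: qm_supp_mul => //; exact: qm_sos.
Qed.

Lemma maximal_qm_semiordering Q : quadratic_module Q -> ~ Q (- 1) ->
  (forall P, quadratic_module P -> ~ P (- 1) -> Q `<=` P -> P = Q) ->
  maximal_semiordering Q.
Proof.
move=> qQ Q1 maxQ; have totQ := maximal_qm_total qQ Q1 maxQ.
have adj g := @maximal_qm_adjoin A Q g qQ maxQ.
have suppM f g : Q f -> Q (- f) -> Q (g * f) /\ Q (- (g * f)).
  by move=> Qf QNf; split; rewrite -?mulNr; exact: qm_supp_mul.
(* For f^2 in the support and -q = 1 + s f, the element 1 + s f is congruent to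
   (1 + s f / 2)^2, so q is in the support; but 1 + s f is a unit modulo f^2. *)
have supp_sqrt f : Q (- f ^+ 2) -> Q f.
  move=> QNf2; apply: contrapT => /adj[q [s [Qq ss qE]]].
  have [h half] := exists_half.
  have [_ QNu] := suppM _ (h ^+ 2 * s ^+ 2) (qm_sqr f qQ) QNf2.
  have QNq : Q (- q).
    have -> : - q = (1 + h * s * f) ^+ 2 + - (h ^+ 2 * s ^+ 2 * f ^+ 2).
      rewrite qE; transitivity (1 + (2 * h) * (s * f)); last by ring.
      by rewrite half; ring.
    by apply: qmD => //; exact: qm_sqr.
  have [Qv _] := suppM _ (1 - s * f) Qq QNq.
  apply: Q1; have -> : - 1 = (1 - s * f) * q + s ^+ 2 * - f ^+ 2 by rewrite qE; ring.
  by apply: qmD => //; exact: qm_sqrM.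
have Qsemi : semiordering Q.
  split=> //.
    by apply/seteqP; split=> // f _; have [|QNf] := totQ f;
      [left|right; exists (- f); rewrite ?opprK].
  split.
  - by apply/suppE; rewrite oppr0; split; exact: qm0.
  - move=> f g /suppE[Qf QNf] /suppE[Qg QNg].
    by apply/suppE; rewrite opprD; split; exact: qmD.
  - by move=> f g /suppE[Qg QNg]; apply/suppE; exact: suppM.
  - by move=> /suppE[].
  move=> f g /suppE[Qfg QNfg].
  have supp_sqrtE h : Q (- h ^+ 2) -> (Q `&` [set - g | g in Q]) h.
    by move=> QNh; apply/suppE; split; apply: supp_sqrt; rewrite ?sqrrN.
  have [QNf2|/adj[q [s [Qq ss qE]]]] := pselect (Q (- f ^+ 2)).
    by left; exact: supp_sqrtE.
  (* Here s f^2 - 1 is in Q; multiply it by g^2 and use that f g is in the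
     support. *)
  right; apply: supp_sqrtE.
  have -> : - g ^+ 2 = g ^+ 2 * q + - (s * (f * g) * (f * g)) by rewrite qE; ring.
  by apply: qmD => //; [exact: qm_sqrM|apply: (suppM _ _ Qfg QNfg).2].
split=> // P [qP _ [_ _ _ P1 _]] QP; apply: maxQ => //.
by move=> PN1; apply: P1; apply/suppE; split=> //; exact: qm1.
Qed.


Lemma proper_sub_maximal_semiordering M : quadratic_module M -> ~ M (- 1) ->
  exists Q, [/\ maximal_semiordering Q, ~ Q (- 1) & M `<=` Q].
Proof.
move=> qM /(exists_maximal_proper_qm qM)[Q [qQ Q1 MQ maxQ]].
by exists Q; split=> //; exact: maximal_qm_semiordering.
Qed.

(** * Archimedean semiorderings and real points *)

Lemma rmorphism_of_fun (L : A -> R) : {morph L : f g / f + g} -> L 1 = 1 ->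
  {morph L : f g / f * g} -> exists alpha : {rmorphism A -> R}, L = alpha.
Proof.
move=> LD L1 LM.
have L0 : L 0 = 0 by apply: (@addrI _ (L 0)); rewrite -LD !addr0.
have LB : zmod_morphism L.
  move=> f g; rewrite LD; congr (_ + _); apply: (@addrI _ (L g)).
  by rewrite -LD !subrr.
pose LBm := GRing.isZmodMorphism.Build A R L LB.
pose LMm := GRing.isMonoidMorphism.Build A R L (conj L1 LM).
by exists (HB.pack L LBm LMm : {rmorphism A -> R}).
Qed.

(** A homomorphism R -> R preserves squares, hence the order, and nonnegativity
    sets determine homomorphisms. *)
Lemma real_ring_endomorphism (alpha : {rmorphism R -> R}) : alpha =1 id.
Proof.
have pos r : 0 <= r -> 0 <= alpha r.
  by move=> r0; rewrite -(sqr_sqrtr r0) rmorphXn sqr_ge0.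
apply: (@nonneg_part_inj R R alpha idfun).
apply/seteqP; split=> r; last exact: pos.
rewrite /nonneg_part/= => ar; rewrite leNgt; apply/negP => r0.
have := pos (- r); rewrite rmorphN oppr_ge0 oppr_ge0 => /(_ (ltW r0)) ra.
have := r0; rewrite lt_neqAle -(fmorph_eq0 alpha) => /andP[+ _].
by rewrite eq_le ar ra.
Qed.

Lemma rmorph_iota (alpha : {rmorphism A -> R}) r : alpha (iota r) = r.
Proof. exact: (real_ring_endomorphism (alpha \o iota)). Qed.

(** The homomorphism sends f to the supremum of the reals r with f - r in Q.
    Totality of Q makes it additive. It is multiplicative because d + f and
    d - f in Q imply d^2 - f^2 in Q, by
    2 d (d^2 - f^2) = (f + d)^2 (d - f) + (d - f)^2 (d + f),
    so the square of an element of value 0 has value 0. *)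
Lemma archimedean_total_sub_nonneg_part Q : archimedean Q ->
  (forall f, Q f \/ Q (- f)) -> ~ Q (- 1) ->
  exists alpha : {rmorphism A -> R}, Q `<=` nonneg_part alpha.
Proof.
move=> [qQ archQ] totQ Q1.
have Qge0 c : Q (iota c) -> 0 <= c.
  move=> Qc; rewrite leNgt; apply/negP => c0; apply: Q1.
  have -> : - 1 = iota (- c^-1) * iota c.
    by rewrite -rmorphM mulNr mulVf ?lt_eqF// rmorphN rmorph1.
  by apply: qm_scale; rewrite ?oppr_ge0 ?invr_le0// ltW.
pose L f : R := sup [set r | Q (f - iota r)].
(* The value is the only c with c - e <= f <= c + e modulo Q for all e > 0. *)
have LP f c : (forall e, 0 < e ->
    Q (f - iota c + iota e) /\ Q (iota c - f + iota e)) -> L f = c.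
  move=> fc; have ubE : ubound [set r | Q (f - iota r)] c.
    move=> r /= Qr; apply/ler_addgt0Pr => e e0.
    rewrite -subr_ge0; apply: Qge0.
    have -> : iota (c + e - r) = (f - iota r) + (iota c - f + iota e).
      by rewrite rmorphB rmorphD; ring.
    by apply: qmD => //; exact: (fc _ e0).2.
  have supE : has_sup [set r | Q (f - iota r)].
    split; last by exists c.
    exists (c - 1) => /=; have [+ _] := fc _ (@ltr01 R).
    by rewrite rmorphB opprB addrCA addrC rmorph1 addrAC.
  apply/eqP; rewrite eq_le; apply/andP; split.
    by apply: ge_sup => //; case: supE.
  apply/ler_addgt0Pr => e e0; rewrite -lerBlDr; apply: ub_le_sup => /=.
    by case: supE.
  have -> : f - iota (c - e) = f - iota c + iota e by rewrite rmorphB; ring.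
  exact: (fc _ e0).1.
have LE f e : 0 < e -> Q (f - iota (L f) + iota e) /\ Q (iota (L f) - f + iota e).
  move=> e0.
  have supE : has_sup [set r | Q (f - iota r)].
    split.
      have [k Qk] := archQ f; exists (- k%:R) => /=.
      by rewrite rmorphN opprK rmorph_nat addrC.
    have [k Qk] := archQ (- f); exists k%:R => r /= Qr.
    rewrite -subr_ge0; apply: Qge0.
    rewrite rmorphB rmorph_nat -[_ - _](_ : k%:R - f + (f - iota r) = _).
      exact: qmD.
    by ring.
  split.
    have [r /= Qr rL] := sup_adherent e0 supE.
    have -> : f - iota (L f) + iota e = f - iota r + iota (r - (L f - e)).
      by rewrite !rmorphB; ring.
    by apply: qmD => //; apply: qm_iota => //; rewrite subr_ge0 ltW.
  have [Qf|] := totQ (f - iota (L f + e)).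
    suff : L f + e <= L f by rewrite gerDl leNgt e0.
    by apply: ub_le_sup => //; case: supE.
  by rewrite opprB rmorphD addrAC.
have LD : {morph L : f g / f + g}.
  move=> f g; apply: LP => e e0; have e20 : 0 < e / 2 by rewrite divr_gt0.
  have [f1 f2] := LE f _ e20; have [g1 g2] := LE g _ e20.
  have -> : iota e = iota (e / 2) + iota (e / 2) by rewrite -rmorphD -splitr.
  rewrite rmorphD; split.
    by have := qmD qQ f1 g1; congr Q; ring.
  by have := qmD qQ f2 g2; congr Q; ring.
have L0 : L 0 = 0.
  apply: LP => e e0; rewrite rmorph0 subrr add0r.
  by split; apply: qm_iota => //; exact: ltW.
have LN f : L (- f) = - L f.
  by apply: (@addrI _ (L f)); rewrite -LD !subrr.
have L1 : L 1 = 1.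
  apply: LP => e e0; rewrite rmorph1 subrr add0r.
  by split; apply: qm_iota => //; exact: ltW.
have LZ r f : L (iota r * f) = r * L f.
  wlog r0 : r / 0 < r => [LZp|].
    have [r0|r0|->] := ltgtP r 0; last by rewrite rmorph0 !mul0r.
      have -> : iota r * f = - (iota (- r) * f) by rewrite rmorphN mulNr opprK.
      by rewrite LN LZp ?oppr_gt0// mulNr opprK.
    exact: LZp.
  apply: LP => e e0.
  have [f1 f2] := LE f _ (divr_gt0 e0 r0).
  have -> : iota e = iota r * iota (e / r) by rewrite -rmorphM mulrC divfK ?gt_eqF.
  rewrite rmorphM -!mulrBr -!mulrDr; split; apply: qm_scale => //; exact: ltW.
have Lsqr0 f : L f = 0 -> L (f ^+ 2) = 0.
  move=> Lf; apply: LP => e e0; rewrite rmorph0 subr0 sub0r; split.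
    by apply: qmD => //; [exact: qm_sqr|apply: qm_iota => //; exact: ltW].
  have d0 : 0 < Num.sqrt e by rewrite sqrtr_gt0.
  have [] := LE f _ d0; rewrite Lf rmorph0 subr0 sub0r => Q1f Q2f.
  set d := iota (Num.sqrt e) in Q1f Q2f.
  have -> : iota e = d ^+ 2 by rewrite -rmorphXn sqr_sqrtr// ltW.
  have -> : - f ^+ 2 + d ^+ 2 = iota ((2 * Num.sqrt e)^-1) *
      ((f + d) ^+ 2 * (- f + d) + (- f + d) ^+ 2 * (f + d)).
    transitivity (iota ((2 * Num.sqrt e)^-1) * (iota 2 * d) * (d ^+ 2 - f ^+ 2)).
      rewrite -!rmorphM mulVf ?mulf_neq0 ?gt_eqF// rmorph1 mul1r; ring.
    by rewrite rmorph_nat; ring.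
  have c0 : 0 <= (2 * Num.sqrt e)^-1 by rewrite invr_ge0 mulr_ge0// ltW.
  by apply: qm_scale => //; apply: qmD => //; exact: qm_sqrM.
have Lsqr f : L (f ^+ 2) = L f ^+ 2.
  pose g := f - iota (L f).
  have Liota r : L (iota r) = r by rewrite -[iota r]mulr1 LZ L1 mulr1.
  have Lg : L g = 0 by rewrite LD -rmorphN Liota subrr.
  have -> : f ^+ 2 = g ^+ 2 + (iota (2 * L f) * g + iota (L f ^+ 2)).
    by rewrite rmorphXn rmorphM rmorph_nat /g; ring.
  by rewrite !LD Lsqr0// LZ Lg Liota mulr0 !add0r.
have LM : {morph L : f g / f * g}.
  move=> f g; have := Lsqr (f + g).
  have -> : (f + g) ^+ 2 = f ^+ 2 + (g ^+ 2 + iota 2 * (f * g)).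
    by rewrite rmorph_nat; ring.
  rewrite !LD LZ !Lsqr; lra.
have [alpha La] := rmorphism_of_fun LD L1 LM.
exists alpha => f Qf; rewrite /nonneg_part/= -La; apply/ler_addgt0Pr => e e0.
apply: Qge0; have [_ Qe] := LE f _ e0.
have -> : iota (L f + e) = f + (iota (L f) - f + iota e) by rewrite rmorphD; ring.
exact: qmD.
Qed.

(** * Certificates over the real points *)

Definition over_archimedean M :=
  forall Q : set A, maximal_semiordering Q -> M `<=` Q -> archimedean Q.

Lemma over_archimedean_sub M N : M `<=` N -> over_archimedean M ->
  over_archimedean N.
Proof. by move=> MN archM Q maxQ NQ; apply: archM => //; exact: subset_trans NQ. Qed.

Lemma proper_has_point M : quadratic_module M -> over_archimedean M ->
  ~ M (- 1) -> exists alpha : {rmorphism A -> R}, M `<=` nonneg_part alpha.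
Proof.
move=> qM archM /(proper_sub_maximal_semiordering qM)[Q [maxQ Q1 MQ]].
have [[_ totQ _] _] := maxQ.
have totQ' f : Q f \/ Q (- f).
  have : [set: A] f by [].
  rewrite -totQ => -[|[g Qg <-]]; [by left|right].
  by rewrite opprK.
have [alpha Qalpha] :=
  archimedean_total_sub_nonneg_part (archM _ maxQ MQ) totQ' Q1.
by exists alpha; exact: subset_trans Qalpha.
Qed.

(** Such a certificate exists because -1 must lie in the module generated by M
    and -f: that module has no real point. *)
Lemma positivstellensatz M f : quadratic_module M -> over_archimedean M ->
  (forall alpha : {rmorphism A -> R}, M `<=` nonneg_part alpha -> 0 < alpha f) ->
  exists2 s, sos s & M (s * f - 1).
Proof.
move=> qM archM fpos.
have [[m [s [Mm ss eq1]]]|] := pselect (qm_adjoin M (- f) (- 1)).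
  exists s => //; have -> : s * f - 1 = m by rewrite eq1 mulrN addrCA subrr addr0.
  exact: Mm.
move=> /proper_has_point[| |alpha Malpha].
- exact: qm_adjoin_qm.
- by apply: over_archimedean_sub archM; exact: qm_adjoin_sub.
have := fpos alpha (subset_trans (@qm_adjoin_sub _ _ _) Malpha).
have := Malpha _ (qm_adjoin_mem (- f) qM).
by rewrite /nonneg_part/= rmorphN oppr_ge0 leNgt => /negP.
Qed.

(** If f were unbounded, the elements that are nonnegative wherever |f| is large
    enough would form a proper quadratic module over M containing f^2 - k for
    all k; no archimedean semiordering can contain it. *)
Lemma bounded_on_points M f : quadratic_module M -> over_archimedean M ->
  exists n : nat, forall alpha : {rmorphism A -> R},
    M `<=` nonneg_part alpha -> `|alpha f| < n%:R.
Proof.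
move=> qM archM.
pose M' := [set g | exists n : nat, forall alpha : {rmorphism A -> R},
  M `<=` nonneg_part alpha -> n%:R <= `|alpha f| -> 0 <= alpha g].
have qM' : quadratic_module M'.
  split.
  - move=> g h [n Hn] [m Hm]; exists (maxn n m) => alpha Ma le_a.
    rewrite rmorphD addr_ge0//; [apply: Hn|apply: Hm] => //; apply: le_trans le_a;
      by rewrite ler_nat leq_max leqnn ?orbT.
  - move=> g h [n Hn]; exists n => alpha Ma le_a.
    by rewrite rmorphM rmorphXn mulr_ge0 ?sqr_ge0//; exact: Hn.
  - by exists 0%N => alpha _ _; rewrite rmorph1.
have MM' : M `<=` M' by move=> g Mg; exists 0%N => alpha Ma _; exact: Ma.
have [[n Hn]|M'1] := pselect (M' (- 1)).
  exists n => alpha Ma; rewrite ltNge; apply/negP => le_a.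
  by have := Hn _ Ma le_a; rewrite rmorphN rmorph1 oppr_ge0 ler10.
have [Q [maxQ Q1 M'Q]] := proper_sub_maximal_semiordering qM' M'1.
have [qQ archQ] := archM _ maxQ (subset_trans MM' M'Q).
have [k Qk] := archQ (- f ^+ 2).
have : M' (f ^+ 2 - k.+1%:R).
  exists k.+1 => alpha Ma le_a.
  rewrite rmorphB rmorphXn rmorph_nat subr_ge0 -real_normK ?num_real//.
  by rewrite (le_trans le_a)// expr2 ler_peMr// (le_trans _ le_a)// ler1n.
move=> /M'Q Qf; exfalso; apply: Q1.
have -> : - 1 = k%:R - f ^+ 2 + (f ^+ 2 - k.+1%:R) by rewrite -natr1; ring.
exact: qmD.
Qed.


(** * The approximate closure of a quadratic module *)

(** Limits of sequences of M along a line, f = lim (f + e g) as e tends to 0+. *)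
Definition eps_closure M : set A :=
  [set f | exists g, forall e : R, 0 < e -> M (f + iota e * g)].

Lemma eps_closure_sub M : M `<=` eps_closure M.
Proof. by move=> f Mf; exists 0 => e _; rewrite mulr0 addr0. Qed.

Lemma eps_closureS M N : M `<=` N -> eps_closure M `<=` eps_closure N.
Proof. by move=> MN f [g Hg]; exists g => e e0; apply: MN; exact: Hg. Qed.

Lemma eps_closure_qm M : quadratic_module M -> quadratic_module (eps_closure M).
Proof.
move=> qM; split.
- move=> f f' [g Hg] [g' Hg']; exists (g + g') => e e0.
  by rewrite mulrDr addrACA; apply: qmD => //; [exact: Hg|exact: Hg'].
- move=> h f [g Hg]; exists (h ^+ 2 * g) => e e0.
  by rewrite mulrCA -mulrDr; apply: qm_sqrM => //; exact: Hg.
- by apply: eps_closure_sub; exact: qm1.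
Qed.

(** Modulo M one has p >= 1 + p x^2, and iterating this bound gives
    p >= 1 + x^2 + ... + x^(2n) + p x^(2n+2). *)
Lemma even_power_le M p x n : quadratic_module M -> sos p ->
  M (p * (1 - x ^+ 2) - 1) -> M (p - (x ^+ n) ^+ 2).
Proof.
move=> qM sp Mp.
have Mpow k : M (p - p * (x ^+ k) ^+ 2).
  elim: k => [|k IHk]; first by rewrite expr0 expr1n mulr1 subrr; exact: qm0.
  have -> : p - p * (x ^+ k.+1) ^+ 2 = p - p * (x ^+ k) ^+ 2 +
      ((x ^+ k) ^+ 2 * (p * (1 - x ^+ 2) - 1) + (x ^+ k) ^+ 2).
    by rewrite (exprS x k); ring.
  by do 2!apply: qmD => //; [exact: qm_sqrM|exact: qm_sqr].
have -> : p - (x ^+ n) ^+ 2 = p - p * (x ^+ n) ^+ 2 +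
    ((x ^+ n) ^+ 2 * (p * (1 - x ^+ 2) - 1) + p * x ^+ n.+1 ^+ 2).
  by rewrite (exprS x n); ring.
apply: qmD => //; apply: qmD => //; first exact: qm_sqrM.
by apply: qm_sosM => //; exact: qm_sqr.
Qed.

(** The inequality y - 1 <= (y^2 - 1) / 2, with the square (y - 1)^2 / 2 as
    difference, applied to y = x^2, x^4, x^8, ... in turn. *)
Lemma one_sub_sqr_approx M x m : quadratic_module M ->
  M (1 - x ^+ 2 + iota (2^-1 ^+ m) * ((x ^+ (2 ^ m)) ^+ 2 - 1)).
Proof.
move=> qM; elim: m => [|m IHm].
  rewrite expr0 rmorph1 mul1r expn0 expr1 addrC subrKA subrr; exact: qm0.
set y := (x ^+ (2 ^ m)) ^+ 2 in IHm *.
have -> : (x ^+ (2 ^ m.+1)) ^+ 2 = y ^+ 2.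
  by rewrite -!exprM expnS; congr (x ^+ _); lia.
set c := iota (2^-1 ^+ m.+1).
have cE : iota (2^-1 ^+ m) = 2 * c.
  by rewrite -(rmorph_nat iota) -rmorphM exprS mulrA mulfV ?pnatr_eq0// mul1r.
have -> : 1 - x ^+ 2 + c * (y ^+ 2 - 1) =
    1 - x ^+ 2 + iota (2^-1 ^+ m) * (y - 1) + c * (y - 1) ^+ 2.
  by rewrite cE; ring.
have c0 : 0 <= 2^-1 ^+ m.+1 :> R by rewrite exprn_ge0// invr_ge0.
by apply: qmD => //; apply: qm_scale => //; exact: qm_sqr.
Qed.

(** The correction x^(2^(m+1)) / 2^m in [one_sub_sqr_approx] is at most p / 2^m. *)
Lemma one_sub_sqr_eps_closure M p x : quadratic_module M -> sos p ->
  M (p * (1 - x ^+ 2) - 1) -> eps_closure M (1 - x ^+ 2).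
Proof.
move=> qM sp Mp; exists p => e e0.
have [m me] : exists m : nat, 2^-1 ^+ m <= e :> R.
  have c0 : (fun m => 2^-1 ^+ m) @ \oo --> (0 : R).
    by apply: cvg_expr; rewrite ger0_norm ?invr_ge0// invf_lt1// ltr1n.
  have /cvgr0_norm_lt/(_ _ e0)[m _ /(_ m (leqnn m))/= /ltW] := c0.
  by rewrite ger0_norm ?exprn_ge0 ?invr_ge0//; exists m.
set c := 2^-1 ^+ m in me *.
have c0 : 0 <= c by rewrite exprn_ge0// invr_ge0.
have -> : 1 - x ^+ 2 + iota e * p =
    (1 - x ^+ 2 + iota c * ((x ^+ (2 ^ m)) ^+ 2 - 1)) +
    (iota c * (p - (x ^+ (2 ^ m)) ^+ 2) + (iota c + iota (e - c) * p)).
  by rewrite rmorphB; ring.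
apply: qmD => //; first exact: one_sub_sqr_approx.
apply: qmD => //; first by apply: qm_scale => //; exact: even_power_le.
apply: qmD => //; first exact: qm_iota.
by apply: qm_scale; rewrite ?subr_ge0//; exact: qm_sos.
Qed.

(** With h a = a / 2 and x = h a / n, the identity
    n^2 + 1 + a = n^2 (1 - x^2) + (h a + 1)^2 reduces the claim to 1 - x^2. *)
Lemma eps_closure_archimedean M : quadratic_module M -> over_archimedean M ->
  archimedean (eps_closure M).
Proof.
move=> qM archM; split; first exact: eps_closure_qm.
move=> a; have [h half] := exists_half.
have [n Hn] := bounded_on_points (h * a) qM archM.
pose x := iota n.+1%:R^-1 * (h * a).
have n1x : n.+1%:R * x = h * a.
  by rewrite mulrA -(rmorph_nat iota) -rmorphM mulfV ?pnatr_eq0// rmorph1 mul1r.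
have [alpha Ma|p sp Mp] := @positivstellensatz M (1 - x ^+ 2) qM archM.
  have ax : `|alpha x| < 1.
    rewrite rmorphM rmorph_iota normrM ger0_norm ?invr_ge0//.
    rewrite mulrC ltr_pdivrMr// mul1r (lt_trans (Hn _ Ma))//.
    by rewrite ltr_nat.
  by rewrite rmorphB rmorph1 rmorphXn subr_gt0 -real_normK ?num_real// expr_lt1.
exists ((n.+1 ^ 2).+1)%N.
have -> : (n.+1 ^ 2).+1%:R + a = n.+1%:R ^+ 2 * (1 - x ^+ 2) + (h * a + 1) ^+ 2.
  rewrite -natr1 natrX mulrBr -exprMn n1x.
  transitivity (n.+1%:R ^+ 2 + 1 + (2 * h) * a); last by ring.
  by rewrite half mul1r.
have qM' := eps_closure_qm qM; apply: qmD => //; last exact: qm_sqr.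
by apply: qm_sqrM => //; exact: one_sub_sqr_eps_closure sp Mp.
Qed.

(** The descent is due to Woermann. From t f - 1 in M and f + r in M with
    r >= 0, the identity
      k^2 (f + r) - 1 = (k - t)^2 (f + r) + 2 k (t f - 1)
                        + (2 k - 1 - t^2 f) + r t (2 k - t)
    gives f + r - 1/k^2 in M once 2 k - t and 2 k - 1 - t^2 f are in M. Since k
    does not depend on r, finitely many steps bring r down to 0. *)
Lemma archimedean_positivstellensatz M f : archimedean M -> over_archimedean M ->
  (forall alpha : {rmorphism A -> R}, M `<=` nonneg_part alpha -> 0 < alpha f) ->
  M f.
Proof.
move=> [qM archM] oarchM fpos.
have [t st Mt] := positivstellensatz qM oarchM fpos.
have [k1 Mk1] := archM (- t).
have [k2 Mk2] := archM (- (t ^+ 2 * f)).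
pose k := (k1 + k2).+1.
have Mk1' : M (2 * k%:R - t).
  have -> : 2 * k%:R - t = (k1%:R - t) + (k1 + k2 + k2 + 2)%:R.
    by rewrite /k -natr1 !natrD; ring.
  by apply: qmD => //; exact: qm_nat.
have Mk2' : M (2 * k%:R - 1 - t ^+ 2 * f).
  have -> : 2 * k%:R - 1 - t ^+ 2 * f =
      (k2%:R - t ^+ 2 * f) + (k1 + k1 + k2 + 1)%:R.
    by rewrite /k -natr1 !natrD; ring.
  by apply: qmD => //; exact: qm_nat.
pose c : R := k%:R^-1 ^+ 2.
have ck : iota c * k%:R ^+ 2 = 1.
  rewrite -(rmorph_nat iota) -rmorphXn -rmorphM -exprMn mulVf ?pnatr_eq0//.
  by rewrite expr1n rmorph1.
have step r : 0 <= r -> M (f + iota r) -> M (f + iota (r - c)).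
  move=> r0 Mfr.
  have -> : f + iota (r - c) = iota c * ((k%:R - t) ^+ 2 * (f + iota r) +
      (2 * k%:R * (t * f - 1) + ((2 * k%:R - 1 - t ^+ 2 * f) +
       iota r * (t * (2 * k%:R - t))))).
    transitivity ((iota c * k%:R ^+ 2) * (f + iota r) - iota c).
      by rewrite ck rmorphB; ring.
    by ring.
  apply: qm_scale => //; first by rewrite exprn_ge0// invr_ge0.
  apply: qmD => //; first exact: qm_sqrM.
  apply: qmD => //.
    by rewrite -natrM -(rmorph_nat iota); exact: qm_scale.
  by apply: qmD => //; apply: qm_scale => //; exact: qm_sosM.
have loop n : forall r, 0 <= r <= n%:R * c -> M (f + iota r) -> M f.
  elim: n => [|n IHn] r /andP[r0 rn] Mfr.
    have /eqP r00 : r == 0 by rewrite eq_le r0 andbT (le_trans rn)// mul0r.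
    by rewrite r00 rmorph0 addr0 in Mfr.
  have [rc|cr] := leP r c.
    have -> : f = (f + iota (r - c)) + iota (c - r) by rewrite !rmorphB; ring.
    by apply: qmD; [|exact: step|apply: qm_iota; rewrite ?subr_ge0].
  apply: (IHn (r - c)); last exact: step.
  by rewrite subr_ge0 ltW//= lerBlDr -[X in _ + X]mul1r -mulrDl natr1.
have [k0 Mk0] := archM f.
apply: (loop (k0 * k ^ 2)%N k0%:R); last by rewrite rmorph_nat addrC.
by rewrite ler0n/= natrM natrX -mulrA /c -exprMn mulfV ?pnatr_eq0// expr1n mulr1.
Qed.

Lemma Pos_sub_eps_closure2 M : quadratic_module M -> over_archimedean M ->
  Pos (K_ R M) `<=` eps_closure (eps_closure M).
Proof.
move=> qM archM f Pf; exists 1 => e e0; rewrite mulr1.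
apply: archimedean_positivstellensatz.
- exact: eps_closure_archimedean.
- by apply: over_archimedean_sub archM; exact: eps_closure_sub.
move=> alpha Ma; rewrite rmorphD rmorph_iota ltr_wpDl//.
apply: (Pf (nonneg_part alpha)); exists alpha => //.
by apply: subset_trans Ma; exact: eps_closure_sub.
Qed.

End RealAlgebras.

(** * Topology *)

Section Topology.
Context {R : realType} {A : comPzRingType}.
Variable iota : {rmorphism R -> A}.
Implicit Types (M C : set A) (f g : A).
Local Notation T := (finest_lc (alg_space iota)).

Lemma seq_closureS C D : C `<=` D -> seq_closure iota C `<=` seq_closure iota D.
Proof. by move=> CD f [u Cu uf]; exists u => // n; exact: CD. Qed.

Lemma eps_closure_sub_seq_closure C : eps_closure iota C `<=` seq_closure iota C.
Proof.
move=> f [g Hg]; pose u n : T := f + iota n.+1%:R^-1 * g.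
exists u => [n|]; first by apply: Hg; rewrite invr_gt0.
move=> U [W bW sW].
have [l l0 Wl] := lc_base_absorb (g : alg_space iota) bW.
have [N _ HN] := near_infty_natSinv_lt (PosNum l0).
exists N => // n Nn; apply: sW; exists (n.+1%:R^-1 *: (g : alg_space iota)) => //.
by apply: Wl; rewrite ger0_norm ?invr_ge0//; exact: ltW (HN n Nn).
Qed.

Lemma seq_closure_sub_lc_closure C : seq_closure iota C `<=` lc_closure iota C.
Proof.
move=> f [u Cu uf] U /uf[N _ NU].
by exists (u N); split; [exact: Cu|apply: NU => /=].
Qed.

Lemma seq_closure2_sub_lc_closure C :
  seq_closure iota (seq_closure iota C) `<=` lc_closure iota C.
Proof.
move=> f /(seq_closureS (@seq_closure_sub_lc_closure C)).
move=> /seq_closure_sub_lc_closure; rewrite /lc_closure.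
by rewrite -(closure_id _).1//; exact: closed_closure.
Qed.

(** For a homomorphism alpha with alpha(f) < 0 the set |alpha| < - alpha(f) is a
    basic zero neighbourhood, and alpha < 0 on its translate by f. *)
Lemma lc_closure_sub_Pos M : lc_closure iota M `<=` Pos (K_ R M).
Proof.
move=> f Mf _ [alpha Ma ->]; rewrite /nonneg_part/= leNgt; apply/negP => af.
pose W := [set g : alg_space iota | `|alpha g| < - alpha f].
have alphaZ r (g : alg_space iota) : alpha (r *: g) = r * alpha g.
  by rewrite [_ *: _](_ : _ = iota r * g)// rmorphM rmorph_iota.
have bW : lc_base W.
  split.
  - move=> g h t; rewrite !inE /W/= => Wg Wh.
    rewrite [X in alpha X](_ : _ = t%:num *: g + (1 - t%:num) *: h)//.
    have t1 : 0 <= 1 - t%:num :> R by rewrite subr_ge0.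
    rewrite rmorphD !alphaZ; apply: (le_lt_trans (ler_normD _ _)).
    rewrite !normrM (ger0_norm t1) ger0_norm//.
    pose m := Num.max `|alpha g| `|alpha h|.
    apply: (@le_lt_trans _ _ m); last by rewrite gt_max Wg Wh.
    rewrite -[leRHS](_ : t%:num * m + (1 - t%:num) * m = m); last by ring.
    by rewrite lerD// ler_wpM2l// le_max lexx ?orbT.
  - move=> g; pose d := `|alpha g| + 1.
    have d0 : 0 < d by rewrite ltr_wpDl.
    have Naf : 0 < - alpha f by rewrite oppr_gt0.
    exists (d / - alpha f); first exact: divr_gt0.
    exists ((d / - alpha f)^-1 *: g); last first.
      by rewrite scalerA divff ?scale1r// gt_eqF// divr_gt0.
    rewrite /W/= alphaZ normrM gtr0_norm ?invr_gt0 ?divr_gt0//.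
    by rewrite invf_div mulrAC ltr_pdivrMr// ltr_pM2l// ltrDl.
  - move=> r r1 _ [g Wg <-]; rewrite /W/= alphaZ normrM.
    by apply: le_lt_trans Wg; rewrite ler_piMl.
have /Mf[g [Mg [w Ww wg]]] : nbhs (f : T) [set (f : alg_space iota) + w | w in W].
  by exists W.
have := Ma _ Mg; rewrite /nonneg_part/= leNgt => /negP; apply.
rewrite -wg rmorphD -ltrBrDl sub0r; apply: le_lt_trans Ww; exact: ler_norm.
Qed.

Lemma Pos_qm M : quadratic_module (Pos (K_ R M)).
Proof.
split.
- move=> f g Pf Pg _ [alpha Ma ->]; rewrite /nonneg_part/= rmorphD addr_ge0//.
    by apply: (Pf (nonneg_part alpha)); exists alpha.
  by apply: (Pg (nonneg_part alpha)); exists alpha.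
- move=> f g Pg _ [alpha Ma ->]; rewrite /nonneg_part/= rmorphM rmorphXn.
  by rewrite mulr_ge0 ?sqr_ge0//; apply: (Pg (nonneg_part alpha)); exists alpha.
- by move=> _ [alpha Ma ->]; rewrite /nonneg_part/= rmorph1.
Qed.

(** Being a homomorphism that is nonnegative on M is a conjunction of closed
    conditions on the values at finitely many elements. *)
Lemma Khom_closed M : closed (Khom R M).
Proof.
have evc f : continuous (fun a : {ptws A -> R} => a f).
  exact: (@proj_continuous A (fun=> R) f).
move=> a cla.
have cl (phi : {ptws A -> R} -> R) (D : set R) : continuous phi -> closed D ->
    (forall alpha : {rmorphism A -> R}, M `<=` nonneg_part alpha ->
       D (phi (alpha : A -> R))) -> D (phi a).
  move=> cphi clD KD; have clP := (continuous_closedP phi).1 cphi D clD.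
  by apply: clP; apply: closure_subset cla => _ [alpha Ma ->]; exact: KD.
have aD : {morph a : f g / f + g}.
  move=> f g; apply/eqP; rewrite -subr_eq0; apply/eqP.
  apply: (cl (fun a => a (f + g) - (a f + a g)) [set x | x = 0]).
  - by move=> b; exact: (cvgB (evc _ b) (cvgD (evc _ b) (evc _ b))).
  - exact: closed_eq.
  - by move=> alpha _ /=; rewrite rmorphD subrr.
have aM : {morph a : f g / f * g}.
  move=> f g; apply/eqP; rewrite -subr_eq0; apply/eqP.
  apply: (cl (fun a => a (f * g) - (a f * a g)) [set x | x = 0]).
  - by move=> b; exact: (cvgB (evc _ b) (cvgM (evc _ b) (evc _ b))).
  - exact: closed_eq.
  - by move=> alpha _ /=; rewrite rmorphM subrr.
have a1 : a 1 = 1.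
  apply: (cl (fun a => a 1) [set x | x = 1]); [exact: evc|exact: closed_eq|].
  by move=> alpha _ /=; rewrite rmorph1.
have [alpha aE] := rmorphism_of_fun aD a1 aM.
exists alpha => // f Mf; rewrite /nonneg_part/= -aE.
apply: (cl (fun a => a f) [set x | 0 <= x]); [exact: evc|exact: closed_ge|].
by move=> beta Mb; exact: Mb.
Qed.

Lemma Khom_compact M :
  (forall f, exists n : nat, forall alpha : {rmorphism A -> R},
     M `<=` nonneg_part alpha -> `|alpha f| < n%:R) ->
  compact (Khom R M).
Proof.
move=> /choice[b Hb].
apply: (@subclosed_compact _ _
  [set a : {ptws A -> R} | forall f, `[- (b f)%:R, (b f)%:R]%classic (a f)]).
- exact: Khom_closed.
- apply: (@tychonoff A (fun=> R) (fun f => `[- (b f)%:R, (b f)%:R]%classic)).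
  by move=> f; exact: segment_compact.
- move=> _ [alpha Ma ->] f; rewrite /= in_itv/= -ler_norml ltW//; exact: Hb.
Qed.

End Topology.

Unset Implicit Arguments.

Theorem theorem3p4 (R : realType) (A : comPzRingType)
    (iota : {rmorphism R -> A}) (M : set A) :
  quadratic_module M ->
  (forall Q : set A, maximal_semiordering Q -> M `<=` Q -> archimedean Q) ->
  [/\ compact (Khom R M),
      seq_closure iota (seq_closure iota M) = lc_closure iota M,
      lc_closure iota M = Pos (K_ R M)
    & archimedean (seq_closure iota (seq_closure iota M))].
Proof.
move=> qM archM.
have PosM : Pos (K_ R M) `<=` seq_closure iota (seq_closure iota M).
  move=> f /(Pos_sub_eps_closure2 iota qM archM).
  move=> /(eps_closureS (@eps_closure_sub_seq_closure _ _ iota M)).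
  exact: eps_closure_sub_seq_closure.
have bM f := bounded_on_points iota f qM archM.
have eq1 : seq_closure iota (seq_closure iota M) = lc_closure iota M.
  apply/seteqP; split; first exact: seq_closure2_sub_lc_closure.
  by move=> f /lc_closure_sub_Pos/PosM.
have eq2 : lc_closure iota M = Pos (K_ R M).
  apply/seteqP; split; first exact: lc_closure_sub_Pos.
  by move=> f /PosM; rewrite eq1.
split=> //; first exact: Khom_compact.
rewrite eq1 eq2; split; first exact: Pos_qm.
move=> f; have [n Hn] := bM f; exists n => _ [alpha Ma ->].
have := Hn _ Ma; rewrite ltr_norml => /andP[+ _].
by rewrite /nonneg_part/= rmorphD rmorph_nat -subr_gt0 opprK addrC => /ltW.
Qed.
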